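(* Let $n\ge 1$, let $\Phi$ be a quantum channel on $n$ qubits, let $\rho$ be an $n$-qubit quantum state (so $\Phi(\rho)$ is the output of a noisy quantum device), let $\sigma=I/2^n$, and let $D(\Phi(\rho)\|\sigma)=n-S(\Phi(\rho))$. Then for every nonzero Hamiltonian $H$ on $n$ qubits and every $\epsilon>0$ there is a $\lambda\in[0,D(\Phi(\rho)\|\sigma)]$ such that the state $$\tilde\sigma=\frac{\exp\left(-\frac{\lambda}{\|H\|\epsilon}H\right)}{\mathcal Z},\qquad \mathcal Z=\mathrm{tr}\left(\exp\left(-\tfrac{\lambda}{\|H\|\epsilon}H\right)\right),$$ satisfies $$\mathrm{tr}\left(H(\tilde\sigma-\Phi(\rho))\right)\le \|H\|\epsilon .$$
   Context: An $n$-qubit state is a positive semidefinite operator of trace one on $(\mathbb C^2)^{\otimes n}$; a Hamiltonian is a Hermitian operator on this space; $\|\cdot\|$ is the operator norm. $S(\omega)=-\mathrm{tr}(\omega\log\omega)$ is the von Neumann entropy, with the logarithm in base $2$ (so that $D(\omega\|I/2^n)=\mathrm{tr}(\omega(\log\omega-\log (I/2^n)))=n-S(\omega)$). The exponential is the usual exponential (base $e$). *)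

(* Defs.v *)
From HB Require Import structures.
From mathcomp Require Import all_boot all_order all_algebra.
From mathcomp Require Import spectral.
From mathcomp Require Import complex.
From mathcomp Require Import all_classical all_reals all_analysis.

Set Implicit Arguments.
Unset Strict Implicit.
Unset Printing Implicit Defensive.

Import Order.TTheory GRing.Theory Num.Theory.
Import numFieldNormedType.Exports.

Local Open Scope classical_set_scope.
Local Open Scope ring_scope.
Local Open Scope complex_scope.
Local Open Scope sesquilinear_scope.

(* In R[i] the order is partial: z <= w means that w - z is a nonnegative
   real, so [0 <= z] also asserts that z is real.  The n-qubit space
   (C^2)^{(x) n} is identified with C^(2^n) through the computational basis. *)

Definition psdmx (R : realType) (d : nat) (A : 'M[R[i]]_d) : Prop :=
  A \is hermsymmx /\ forall x : 'cV[R[i]]_d, 0 <= (x^t* *m A *m x) 0 0.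

Definition density (R : realType) (d : nat) (rho : 'M[R[i]]_d) : Prop :=
  psdmx rho /\ \tr rho = 1.

(* id_k (x) Phi on M_k (x) M_d, the latter seen as the k x k block matrices
   with blocks of size d. *)
Definition ampliation (R : realType) (d : nat)
    (Phi : 'M[R[i]]_d -> 'M[R[i]]_d) (k : nat)
    (A : 'M[R[i]]_(\sum_(i < k) d)) : 'M[R[i]]_(\sum_(i < k) d) :=
  \mxblock_(i < k, j < k) Phi (submxblock A i j).

Definition completely_positive (R : realType) (d : nat)
    (Phi : 'M[R[i]]_d -> 'M[R[i]]_d) : Prop :=
  forall (k : nat) (A : 'M[R[i]]_(\sum_(i < k) d)),
    psdmx A -> psdmx (ampliation Phi A).

Definition quantum_channel (R : realType) (d : nat)
    (Phi : {linear 'M[R[i]]_d -> 'M[R[i]]_d}) : Prop :=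
  completely_positive Phi /\ forall A : 'M[R[i]]_d, \tr (Phi A) = \tr A.

Definition l2norm (R : realType) (d : nat) (x : 'cV[R[i]]_d) : R :=
  Num.sqrt (\sum_(i < d) Normc.normc (x i 0) ^+ 2).

Definition opnorm (R : realType) (d : nat) (A : 'M[R[i]]_d) : R :=
  sup [set l2norm (A *m x) | x in [set x : 'cV[R[i]]_d | l2norm x <= 1]].

Definition expmx (R : realType) (d : nat) (A : 'M[R[i]]_d) : 'M[R[i]]_d :=
  limn (series (fun k : nat => (k`!%:R)^-1 *: A ^+ k)).

(* Functional calculus for Hermitian A: the spectral theorem gives
   A = U^* diag(a) U with U = spectralmx A and a = spectral_diag A real. *)
Definition hermfun (R : realType) (d : nat) (f : R -> R) (A : 'M[R[i]]_d) :
    'M[R[i]]_d :=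
  (spectralmx A)^t* *m
  diag_mx (map_mx (fun z : R[i] => (f (complex.Re z))%:C) (spectral_diag A)) *m
  spectralmx A.

Definition log2 (R : realType) (x : R) : R := ln x / ln 2.

(* [ln 0 = 0], so zero eigenvalues contribute 0 log 0 = 0. The trace below is
   real for Hermitian omega; [complex.Re] only casts it to R. *)
Definition entropy (R : realType) (d : nat) (omega : 'M[R[i]]_d) : R :=
  - complex.Re (\tr (omega *m hermfun (@log2 R) omega)).

(* Main.v *)
(* Take lambda = D.  Diagonalise omega = Phi(rho) and H with spectra p and h;
   the squared moduli w of the overlaps of the two eigenbases form a doubly
   stochastic matrix and tr(H omega) = sum_ij p_i h_j w_ij.  With
   beta = lambda / (|H| eps), the Gibbs state minimises the free energy, so
   beta tr(H (sigma~ - omega)) <= S(sigma~) - S(omega) <= n ln 2 - S(omega)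
   in nats, that is D ln 2 <= D.  Dividing by beta gives the bound unless D = 0,
   in which case omega = I/2^n = sigma~. *)
Require Import Defs.
From HB Require Import structures.
From mathcomp Require Import all_boot all_order all_algebra.
From mathcomp Require Import spectral complex.
From mathcomp Require Import all_classical all_reals all_analysis.
From mathcomp Require Import ring lra.

Set Implicit Arguments.
Unset Strict Implicit.
Unset Printing Implicit Defensive.

Import Order.TTheory GRing.Theory Num.Theory.
Import numFieldNormedType.Exports.

Local Open Scope ring_scope.
Local Open Scope complex_scope.
Local Open Scope sesquilinear_scope.

(** * Pointwise logarithm inequalities *)

Lemma ln_leB1 (R : realType) (x : R) : 0 < x -> ln x <= x - 1.
Proof.
move=> x0; have := @le_ln1Dx R (x - 1).
by rewrite addrCA subrr addr0; apply; rewrite ltrBrDl subrr.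
Qed.

Lemma ln_ltB1 (R : realType) (x : R) : 0 < x -> x != 1 -> ln x < x - 1.
Proof.
move=> x0 x1; have := @expR_gt1Dx R (ln x).
by rewrite ln_eq0 // x1 lnK // => /(_ isT); rewrite ltrBrDl.
Qed.

(** One summand of a relative entropy. The correction [x - y] makes the bound hold termwise and
    cancels when summed over two probability vectors. *)
Lemma relent_ge (R : realType) (x y : R) : 0 <= x -> 0 < y ->
  x - y <= x * ln x - x * ln y.
Proof.
rewrite le_eqVlt => /predU1P[<-|x0] y0; first by
  rewrite !mul0r !sub0r oppr0 oppr_le0 ltW.
have := @ln_leB1 R (y / x) (divr_gt0 y0 x0).
rewrite ln_div // -(ler_pM2l x0) !mulrBr mulr1 mulrCA divff ?gt_eqF // mulr1.
lra.
Qed.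

Lemma relent_gt (R : realType) (x y : R) : 0 <= x -> 0 < y -> x != y ->
  x - y < x * ln x - x * ln y.
Proof.
rewrite le_eqVlt => /predU1P[<-|x0] y0 xy; first by
  rewrite !mul0r !sub0r oppr0 oppr_lt0.
have yx1 : y / x != 1.
  by apply: contra_neq xy => yx; rewrite -[y](divfK (lt0r_neq0 x0)) yx mul1r.
have := ln_ltB1 (divr_gt0 y0 x0) yx1.
rewrite ln_div // -(ltr_pM2l x0) !mulrBr mulr1 mulrCA divff ?gt_eqF // mulr1.
lra.
Qed.

(** * Relative entropy of finite distributions *)

Section Classical.
Variables (R : realType) (d : nat) (p : 'I_d -> R).
Hypotheses (p_ge0 : forall i, 0 <= p i) (p_sum : \sum_i p i = 1).

Let d_gt0 : 0 < d%:R :> R.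
Proof.
rewrite ltr0n lt0n; apply/eqP => d0; have := p_sum.
rewrite big1 => [/eqP|i]; first by rewrite eq_sym oner_eq0.
by have := ltn_ord i; rewrite [X in (_ < X)%N]d0.
Qed.

Let uniform_sum : \sum_(i < d) d%:R^-1 = 1 :> R.
Proof. by rewrite sumr_const card_ord -[LHS]mulr_natr mulVf ?gt_eqF. Qed.

(** Subtracting [p i - d%:R^-1], of total 0, makes every summand nonnegative by [relent_ge]. *)
Let relent_uniformE :
  \sum_i p i * ln (p i) + ln d%:R =
  \sum_i (p i * ln (p i) - p i * ln d%:R^-1 - (p i - d%:R^-1)).
Proof.
rewrite !sumrB p_sum uniform_sum subrr subr0 -mulr_suml p_sum mul1r.
by rewrite lnV ?opprK.
Qed.

Lemma relent_uniform_ge0 : 0 <= \sum_i p i * ln (p i) + ln d%:R.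
Proof.
rewrite relent_uniformE sumr_ge0 // => i _.
by rewrite subr_ge0 relent_ge // invr_gt0.
Qed.

(** A vanishing sum of nonnegative terms has only zero terms, and [relent_gt] makes the term
    strictly positive away from uniformity. *)
Lemma relent_uniform_eq0 i :
  \sum_i p i * ln (p i) + ln d%:R = 0 -> p i = d%:R^-1.
Proof.
rewrite relent_uniformE => /eqP; rewrite psumr_eq0 => [/allP/(_ i)|j _].
  rewrite mem_index_enum => /(_ isT) /=; apply: contraTeq => pi_neq.
  by rewrite gt_eqF // subr_gt0 relent_gt // invr_gt0.
by rewrite subr_ge0 relent_ge // invr_gt0.
Qed.

End Classical.

(* Add the relative entropy of p with respect to the Gibbs weights q, averaged
   over the doubly stochastic w, to that of q with respect to the uniform
   weights: both are nonnegative, and the ln Z terms cancel. *)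
Lemma gibbs_energy_le (R : realType) (d : nat) (p h : 'I_d -> R)
    (w : 'I_d -> 'I_d -> R) (beta : R)
    (Z := \sum_j expR (- beta * h j)) :
    (forall i, 0 <= p i) -> \sum_i p i = 1 ->
    (forall i j, 0 <= w i j) -> (forall i, \sum_j w i j = 1) ->
    (forall j, \sum_i w i j = 1) ->
  beta * (\sum_j h j * (expR (- beta * h j) / Z) -
          \sum_i \sum_j p i * h j * w i j) <=
  \sum_i p i * ln (p i) + ln d%:R.
Proof.
move=> p0 p1 w0 wr wc.
have Z0 : 0 < Z.
  rewrite lt_neqAle sumr_ge0 ?andbT => [|i _]; last exact: expR_ge0.
  (* Positive exponentials sum to 0 only over an empty index set, which [p1] rules out. *)
  apply/eqP => /esym/eqP; rewrite psumr_eq0 => [/allP Z0|i _]; last exact: expR_ge0.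
  have /eqP := p1; rewrite big1 => [|i _]; first by rewrite eq_sym oner_eq0.
  by have := Z0 i (mem_index_enum _); rewrite gt_eqF ?expR_gt0.
pose q j := expR (- beta * h j) / Z.
have q0 j : 0 < q j by rewrite divr_gt0 ?expR_gt0.
have q1 : \sum_j q j = 1 by rewrite -mulr_suml mulfV ?gt_eqF.
have lnq j : ln (q j) = - beta * h j - ln Z.
  by rewrite ln_div ?posrE ?expR_gt0 // expRK.
have := relent_uniform_ge0 (fun j => ltW (q0 j)) q1.
under eq_bigr do rewrite lnq mulrBr.
rewrite sumrB -[X in _ - X]mulr_suml q1 mul1r.
have -> : \sum_i q i * (- beta * h i) = - beta * \sum_j h j * q j.
  by rewrite mulr_sumr; apply: eq_bigr => j _; ring.
pose gap i j := p i * ln (p i) - p i * ln (q j) - (p i - q j).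
have : 0 <= \sum_i \sum_j w i j * gap i j.
  by do 2! (apply: sumr_ge0 => ? _); rewrite mulr_ge0 // subr_ge0 relent_ge.
(* Row sums of [w] collapse the terms in i alone, column sums the term in [q j]; the linear
   corrections cancel since [p] and [q] both have total 1. *)
have -> : \sum_i \sum_j w i j * gap i j =
    \sum_i p i * ln (p i) + beta * (\sum_i \sum_j p i * h j * w i j) + ln Z.
  have -> : \sum_i \sum_j w i j * gap i j =
      \sum_i \sum_j w i j * (p i * ln (p i)) +
      \sum_i \sum_j beta * (p i * h j * w i j) +
      \sum_i \sum_j w i j * (p i * ln Z) -
      (\sum_i \sum_j w i j * p i - \sum_i \sum_j w i j * q j).
    rewrite -!sumrB -!big_split /= -sumrB; apply: eq_bigr => i _.
    rewrite -!sumrB -!big_split /= -sumrB; apply: eq_bigr => j _.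
    by rewrite /gap lnq; ring.
  have row F : \sum_i \sum_j w i j * F i = \sum_i F i.
    by apply: eq_bigr => i _; rewrite -mulr_suml wr mul1r.
  rewrite !row [X in _ - (_ - X)]exchange_big /=.
  under [X in _ - (_ - X)]eq_bigr do rewrite -mulr_suml wc mul1r.
  rewrite p1 q1 -mulr_suml p1 mul1r subrr subr0; congr (_ + _ + _).
  by rewrite mulr_sumr; apply: eq_bigr => i _; rewrite mulr_sumr.
rewrite -/q; lra.
Qed.

(** * Real diagonal matrices in a unitary basis *)

Definition udiag (R : realType) (d : nat) (U : 'M[R[i]]_d) (a : 'I_d -> R) :
    'M[R[i]]_d :=
  U^t* *m diag_mx (\row_i (a i)%:C) *m U.

(** For unitary [U] the conjugated rows of [U] are eigenvectors of [udiag U a], so this is the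
    transition probability between two eigenbases. *)
Definition overlap (R : realType) (d : nat) (U V : 'M[R[i]]_d) (i j : 'I_d) : R :=
  Normc.normc ((U *m V^t*) i j) ^+ 2.

Lemma hermitian_udiag (R : realType) (d : nat) (A : 'M[R[i]]_d) :
  A \is hermsymmx ->
  A = udiag (spectralmx A) (fun i => complex.Re (spectral_diag A 0 i)).
Proof.
move=> Ah.
have aE : \row_i (complex.Re (spectral_diag A 0 i))%:C = spectral_diag A.
  apply/rowP => i; rewrite mxE RRe_real //.
  exact: (mxOverP (hermitian_spectral_diag_real Ah)).
rewrite /udiag aE -invmx_unitary ?spectral_unitarymx //.
exact/orthomx_spectralP/hermitian_normalmx.
Qed.

Lemma hermfunE (R : realType) (d : nat) (f : R -> R) (A : 'M[R[i]]_d) :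
  hermfun f A = udiag (spectralmx A) (fun i => f (complex.Re (spectral_diag A 0 i))).
Proof.
rewrite /hermfun /udiag.
have -> : map_mx (fun z : R[i] => (f (complex.Re z))%:C) (spectral_diag A) =
  \row_i (f (complex.Re (spectral_diag A 0 i)))%:C.
  by apply/rowP => i; rewrite !mxE.
by [].
Qed.

Lemma conjCE (R : realType) (z : R[i]) : (z^*)%R = z^*%C.
Proof. by []. Qed.

Section UnitaryDiag.
Variables (R : realType) (d : nat).
Implicit Types (U V : 'M[R[i]]_d) (a b : 'I_d -> R).

Lemma unitarymx_trC U : U \is unitarymx -> U^t* *m U = 1%:M.
Proof. by move=> Uu; rewrite -invmx_unitary // mulVmx ?unitarymx_unit. Qed.

Lemma normc_sqr (z : R[i]) : (Normc.normc z ^+ 2)%:C = z * z^*%C.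
Proof. by rewrite -sqr_normc rmorphXn. Qed.

Lemma overlap_ge0 U V i j : 0 <= overlap U V i j.
Proof. exact: sqr_ge0. Qed.

Lemma overlapC U V i j : overlap U V i j = overlap V U j i.
Proof.
apply: complexI; rewrite !normc_sqr mulrC.
suff -> : (U *m V^t*) i j = ((V *m U^t*) j i)^*%C by rewrite conjcK.
by rewrite -conjCE -[in LHS](trmxCK U) -map_mxM -trmx_mul !mxE.
Qed.

(** The matrix W = U V^* is unitary, and the sum is a diagonal entry of W W^* = 1. *)
Lemma overlap_row U V i : U \is unitarymx -> V \is unitarymx ->
  \sum_j overlap U V i j = 1.
Proof.
move=> Uu Vu; apply: complexI; rewrite rmorph_sum /=.
have VCu : V^t* \is unitarymx by rewrite trmxC_unitary.
have Wu := mul_unitarymx Uu VCu.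
transitivity ((1%:M : 'M[R[i]]_d) i i); last by rewrite mxE eqxx.
rewrite -(unitarymxP Wu) mxE.
by apply: eq_bigr => j _; rewrite normc_sqr -conjCE !mxE.
Qed.

Lemma overlap_col U V j : U \is unitarymx -> V \is unitarymx ->
  \sum_i overlap U V i j = 1.
Proof. by move=> Uu Vu; under eq_bigr do rewrite overlapC; apply: overlap_row. Qed.

Lemma overlapE U V i j :
  (overlap U V i j)%:C = (U *m V^t*) i j * ((U *m V^t*)^t*) j i.
Proof. by rewrite normc_sqr -conjCE; move: (U *m V^t*) => W; rewrite !mxE. Qed.

(** By cyclicity this is the trace of diag(a) W diag(b) W^* with W = U V^*. *)
Lemma tr_udiagM U V a b :
  \tr (udiag U a *m udiag V b) =
  (\sum_i \sum_j a i * b j * overlap U V i j)%:C.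
Proof.
pose W := U *m V^t*.
have WC : W^t* = V *m U^t* by rewrite trmx_mul map_mxM trmxCK.
have -> : \tr (udiag U a *m udiag V b) =
    \tr (diag_mx (\row_i (a i)%:C) *m W *m diag_mx (\row_i (b i)%:C) *m W^t*).
  by rewrite WC /udiag !mulmxA [RHS]mxtrace_mulC !mulmxA.
rewrite /mxtrace rmorph_sum; apply: eq_bigr => i _.
rewrite mxE rmorph_sum; apply: eq_bigr => j _.
rewrite 2!rmorphM [X in _ = _ * X](overlapE U V i j) -/W mul_mx_diag mul_diag_mx.
rewrite mxE [X in X * _ * _]mxE ![(\row_ _ _) _ _]mxE /=.
ring.
Qed.

Lemma mul_udiag U a b : U \is unitarymx ->
  udiag U a *m udiag U b = udiag U (fun i => a i * b i).
Proof.
move=> Uu.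
have dE : diag_mx (\row_i (a i)%:C) *m diag_mx (\row_i (b i)%:C) =
    diag_mx (\row_i (a i * b i)%:C) :> 'M[R[i]]_d.
  by rewrite mulmx_diag; congr diag_mx; apply/rowP => i; rewrite !mxE rmorphM.
by rewrite /udiag -dE -!mulmxA (mulmxA U) (unitarymxP Uu) mul1mx.
Qed.

Lemma udiag1 U : U \is unitarymx -> udiag U (fun=> 1) = 1%:M.
Proof.
move=> Uu; rewrite /udiag.
have -> : \row_(i < d) 1%:C = const_mx 1 :> 'rV[R[i]]_d by apply/rowP => i; rewrite !mxE.
by rewrite diag_const_mx mulmx1 unitarymx_trC.
Qed.

Lemma udiagX U a k : U \is unitarymx ->
  udiag U a ^+ k = udiag U (fun i => a i ^+ k).
Proof.
move=> Uu; elim: k => [|k IH]; first by rewrite expr0; apply/esym/udiag1.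
have -> : (fun i => a i ^+ k.+1) = (fun i => a i * a i ^+ k).
  by apply/funext => i; rewrite exprS.
rewrite -mul_udiag // -IH.
by rewrite exprS.
Qed.

Lemma udiagZ U a c : c%:C *: udiag U a = udiag U (fun i => c * a i).
Proof.
have dE : c%:C *: diag_mx (\row_i (a i)%:C) =
    diag_mx (\row_i (c * a i)%:C) :> 'M[R[i]]_d.
  by apply/matrixP => i j; rewrite !mxE mulrnAr rmorphM.
by rewrite /udiag -dE scalemxAl scalemxAr.
Qed.

Lemma tr_udiag U a : U \is unitarymx -> \tr (udiag U a) = (\sum_i a i)%:C.
Proof.
move=> Uu; rewrite /udiag mxtrace_mulC mulmxA (unitarymxP Uu) mul1mx mxtrace_diag.
by rewrite rmorph_sum; apply: eq_bigr => i _; rewrite mxE.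
Qed.

(** With the matrices fixed and only scalar coefficients varying, matrix convergence reduces to that
    of each coefficient. *)
Lemma udiag_sum U a :
  udiag U a = \sum_k (a k)%:C *: (U^t* *m delta_mx k k *m U).
Proof.
rewrite /udiag diag_mx_sum_delta mulmx_sumr mulmx_suml; apply: eq_bigr => k _.
by rewrite mxE -scalemxAr -scalemxAl.
Qed.

Lemma cvg_real_complex (u : R ^nat) (l : R) :
  (u @ \oo --> l -> (fun n => (u n)%:C : (R[i] : numFieldType)) @ \oo -->
    (l%:C : (R[i] : numFieldType)))%classic.
Proof.
move=> ul; apply/cvgrPdist_lt => e e0.
(* A positive element of [R[i]] is real, so the tolerance can be passed to the real limit. *)
have eR : e = (complex.Re e)%:C by rewrite RRe_real // gtr0_real.
move: e0; rewrite eR ltcR => e0; move/cvgrPdist_lt : ul => /(_ _ e0).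
apply: filterS => n; rewrite -rmorphB /= normc_def /= expr0n addr0 sqrtr_sqr.
by rewrite ltcR.
Qed.

(** Powers act on the eigenvalues, so the partial sums have scalar exponential series as
    coefficients. *)
Lemma expmx_udiag U a : U \is unitarymx ->
  expmx (udiag U a) = udiag U (fun i => expR (a i)).
Proof.
move=> Uu; rewrite /expmx.
have sE : series (fun k => (k`!%:R)^-1 *: udiag U a ^+ k) =
  fun n => \sum_k (series (exp_coeff (a k)) n)%:C *: (U^t* *m delta_mx k k *m U).
  apply/funext => n; rewrite /series /= -udiag_sum.
  have -> : udiag U (fun k => \sum_(0 <= k0 < n) exp_coeff (a k) k0) =
      \sum_(0 <= k0 < n) udiag U (fun k => exp_coeff (a k) k0).
    rewrite udiag_sum; under [RHS]eq_bigr do rewrite udiag_sum.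
    rewrite exchange_big /=; apply: eq_bigr => k _.
    by rewrite rmorph_sum scaler_suml.
  apply: eq_bigr => k _; rewrite udiagX //.
  have -> : (k`!%:R : R[i])^-1 = ((k`!%:R)^-1 : R)%:C by rewrite fmorphV rmorph_nat.
  by rewrite udiagZ; congr udiag; apply/funext => i; rewrite /exp_coeff /= mulrC.
have scvg : ((fun n => \sum_k (series (exp_coeff (a k)) n)%:C *:
      (U^t* *m delta_mx k k *m U) : 'M[(R[i] : numFieldType)]_d) @ \oo -->
    (udiag U (fun i => expR (a i)) : 'M[(R[i] : numFieldType)]_d))%classic.
  rewrite udiag_sum; apply: cvg_big => [|k _]; first exact: add_continuous.
  by apply: cvgZr_tmp; apply: cvg_real_complex; exact: is_cvg_series_exp_coeff.
rewrite -sE in scvg.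
exact: (cvg_lim (@norm_hausdorff _ _) scvg).
Qed.

End UnitaryDiag.

(** * Operator norm *)

Lemma sqr_l2norm (R : realType) (d : nat) (x : 'cV[R[i]]_d) :
  l2norm x ^+ 2 = \sum_i Normc.normc (x i 0) ^+ 2.
Proof. by rewrite sqr_sqrtr // sumr_ge0 // => i _; exact: sqr_ge0. Qed.

Lemma normc_ge0 (R : realType) (z : R[i]) : 0 <= Normc.normc z.
Proof. by case: z => a b; exact: sqrtr_ge0. Qed.

Lemma normc_sum (R : realType) (I : finType) (F : I -> R[i]) :
  Normc.normc (\sum_i F i) <= \sum_i Normc.normc (F i).
Proof.
rewrite -lecR rmorph_sum.
exact: (@ler_norm_sum R[i] R[i] I (index_enum I) F xpredT).
Qed.

Lemma normc_le_l2norm (R : realType) (d : nat) (x : 'cV[R[i]]_d) i :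
  Normc.normc (x i 0) <= l2norm x.
Proof.
rewrite -ler_sqr ?nnegrE ?normc_ge0 ?sqrtr_ge0 // sqr_l2norm (bigD1 i) //= lerDl.
by rewrite sumr_ge0 // => j _; exact: sqr_ge0.
Qed.

(** Makes the [sup] in [opnorm] a genuine supremum. On the unit ball each coordinate has modulus at
    most 1, so absolute row sums bound the image. *)
Lemma opnorm_has_ubound (R : realType) (d : nat) (A : 'M[R[i]]_d) :
  has_ubound [set l2norm (A *m x) | x in [set x : 'cV[R[i]]_d | l2norm x <= 1]]%classic.
Proof.
exists (Num.sqrt (\sum_i (\sum_j Normc.normc (A i j)) ^+ 2)) => _ [x /= x1 <-].
rewrite ler_wsqrtr // ler_sum // => i _; rewrite ler_sqr ?nnegrE ?normc_ge0 //.
  rewrite mxE (le_trans (normc_sum _)) // ler_sum // => j _.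
  by rewrite Normc.normcM ler_piMr ?normc_ge0 // (le_trans (normc_le_l2norm _ _)).
by rewrite sumr_ge0 // => j _; exact: normc_ge0.
Qed.

(** If [A i j] is nonzero, the basis vector e_j lies in the unit ball and A e_j has norm at least
    |A_ij|. *)
Lemma opnorm_gt0 (R : realType) (d : nat) (A : 'M[R[i]]_d) : A != 0 -> 0 < opnorm A.
Proof.
move=> A0; have /existsP[i /existsP[j Aij]] : [exists i, exists j, A i j != 0].
  apply: contra_neqT A0 => /existsPn A0; apply/matrixP => i j; rewrite mxE.
  by have /existsPn/(_ j)/negPn/eqP := A0 i.
have entry k : (A *m delta_mx j 0 : 'cV_d) k 0 = A k j.
  rewrite mxE (bigD1 j) //= mxE !eqxx mulr1 big1 ?addr0 // => l lj.
  by rewrite mxE (negPf lj) mulr0.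
apply: (@lt_le_trans _ _ (l2norm (A *m delta_mx j 0))).
  apply: lt_le_trans (normc_le_l2norm _ i); rewrite entry lt_def normc_ge0 andbT.
  by apply: contra_neq Aij; exact: Normc.eq0_normc.
apply: ub_le_sup; first exact: opnorm_has_ubound.
exists (delta_mx j 0) => //=.
rewrite /l2norm (bigD1 j) //= mxE !eqxx Normc.normc1 big1 ?addr0 ?expr1n ?sqrtr1 // => l lj.
by rewrite mxE (negPf lj) Normc.normc0 expr0n.
Qed.

(** * Channels, states and entropy *)

Lemma psdmx_cast (R : realType) (d e : nat) (de : d = e) (A : 'M[R[i]]_d) :
  psdmx (castmx (de, de) A) <-> psdmx A.
Proof. by case: e / de; rewrite castmx_id. Qed.

(** The case k = 1 of complete positivity; casts identify a single block of size d with the whole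
    matrix. *)
Lemma channel_psdmx (R : realType) (d : nat)
    (Phi : {linear 'M[R[i]]_d -> 'M[R[i]]_d}) (A : 'M[R[i]]_d) :
  completely_positive Phi -> psdmx A -> psdmx (Phi A).
Proof.
move=> cp Apsd; rewrite (mxEmxblock (Phi A)) psdmx_cast.
have := cp 1 (\mxblock_(_ < 1, _ < 1) A).
rewrite {1}(mxEmxblock A) psdmx_cast in Apsd.
by move=> /(_ Apsd); rewrite /ampliation; under eq_mxblock do rewrite mxblockK.
Qed.

(** Each [p i] is the quadratic form of [A] at an eigenvector, and the trace is basis
    independent. *)
Lemma density_spectral (R : realType) (d : nat) (A : 'M[R[i]]_d)
    (p := fun i => complex.Re (spectral_diag A 0 i)) :
  density A -> (forall i, 0 <= p i) /\ \sum_i p i = 1.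
Proof.
move=> [[Ah Apos] Atr]; have Uu := spectral_unitarymx A.
have AE := hermitian_udiag Ah.
split=> [i|]; last first.
  by apply: complexI; rewrite -(tr_udiag _ Uu) -AE Atr.
set W := spectralmx A in Uu AE *.
have WAW : W *m A *m W^t* = diag_mx (\row_i (p i)%:C).
  by rewrite {1}AE /udiag !mulmxA (unitarymxP Uu) mul1mx -mulmxA (unitarymxP Uu) mulmx1.
have colC : (col i (W^t*))^t* = row i W.
  by rewrite -[in RHS](trmxCK W); move: (W^t*) => X; apply/rowP => j; rewrite !mxE.
have := Apos (col i (W^t*)).
rewrite colC -row_mul.
have -> : (row i (W *m A) *m col i (W^t*)) 0 0 = (W *m A *m W^t*) i i.
  by rewrite !mxE; apply: eq_bigr => j _; rewrite [row _ _ _ _]mxE [col _ _ _ _]mxE.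
by rewrite WAW !mxE eqxx mulr1n lecR.
Qed.

Lemma entropyE (R : realType) (d : nat) (A : 'M[R[i]]_d)
    (p := fun i => complex.Re (spectral_diag A 0 i)) :
  A \is hermsymmx -> entropy A = - ((\sum_i p i * ln (p i)) / ln 2).
Proof.
move=> Ah; have Uu := spectral_unitarymx A.
rewrite /entropy hermfunE {1}(hermitian_udiag Ah) mul_udiag // tr_udiag //=.
by rewrite mulr_suml; congr (- _); apply: eq_bigr => i _; rewrite mulrA.
Qed.

(** * Gibbs states at inverse temperature D / c *)

Lemma ln2_gt0 (R : realType) : 0 < ln 2 :> R.
Proof. by rewrite ln_gt0 // ltr1n. Qed.

Lemma ln2_le1 (R : realType) : ln 2 <= 1 :> R.
Proof. by rewrite (le_trans (ln_leB1 _)) // lerBlDr. Qed.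

(** Here [c] plays the role of |H| eps, and [D] is the relative entropy to the uniform distribution
    in bits. *)
Lemma gibbs_energy_le_cst (R : realType) (d : nat) (p h : 'I_d -> R)
    (w : 'I_d -> 'I_d -> R) (c : R)
    (D := (\sum_i p i * ln (p i) + ln d%:R) / ln 2)
    (Z := \sum_j expR (- (D / c) * h j)) :
    (forall i, 0 <= p i) -> \sum_i p i = 1 ->
    (forall i j, 0 <= w i j) -> (forall i, \sum_j w i j = 1) ->
    (forall j, \sum_i w i j = 1) -> 0 < c ->
  \sum_j h j * (expR (- (D / c) * h j) / Z) -
    \sum_i \sum_j p i * h j * w i j <= c.
Proof.
move=> p0 p1 w0 wr wc c0.
have DE : \sum_i p i * ln (p i) + ln d%:R = D * ln 2.
  by rewrite divfK // gt_eqF // ln2_gt0.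
have : 0 <= D by rewrite -(pmulr_lge0 _ (ln2_gt0 R)) -DE relent_uniform_ge0.
rewrite le_eqVlt => /predU1P[D0|D0].
  (* Here beta = 0 and the variational bound is void; the equality case of
     Gibbs' inequality gives p = 1/d instead. *)
  have pE i : p i = d%:R^-1 by apply: relent_uniform_eq0; rewrite // DE -D0 mul0r.
  have ZE : Z = d%:R.
    rewrite /Z -D0 mul0r oppr0; under eq_bigr do rewrite mul0r expR0.
    by rewrite sumr_const card_ord.
  rewrite ZE -D0 mul0r oppr0; under eq_bigr do rewrite mul0r expR0 mul1r.
  (* Both energies are the plain mean of [h], by the column sums of [w]. *)
  rewrite exchange_big /= -sumrB big1 ?ltW // => j _.
  under eq_bigr do rewrite pE -mulrA.
  by rewrite -mulr_sumr -mulr_sumr wc mulr1 mulrC subrr.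
have := gibbs_energy_le h (D / c) p0 p1 w0 wr wc.
rewrite DE mulrC -ler_pdivlMr ?(divr_gt0 D0 c0) // => /le_trans; apply.
(* The entropy bound in nats is D ln 2; dividing by beta = D / c leaves c ln 2, at most c. *)
have -> : D * ln 2 / (D / c) = c * ln 2 by field; rewrite !gt_eqF.
by rewrite ler_piMr ?ln2_le1 // ltW.
Qed.

(** The Gibbs state shares the eigenbasis of its Hamiltonian, so overlaps enter only through the
    other state. *)
Lemma tr_gibbs_sub (R : realType) (d : nat) (U V : 'M[R[i]]_d) (h p : 'I_d -> R)
    (c : R) (E := expmx (c%:C *: udiag U h)) :
    U \is unitarymx ->
  \tr (udiag U h *m ((\tr E)^-1 *: E - udiag V p)) =
  (\sum_j h j * (expR (c * h j) / \sum_k expR (c * h k)) -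
   \sum_i \sum_j p i * h j * overlap V U i j)%:C.
Proof.
move=> Uu; have EE : E = udiag U (fun j => expR (c * h j)).
  by rewrite /E udiagZ expmx_udiag.
have -> : (\tr E)^-1 = ((\sum_k expR (c * h k))^-1)%:C by rewrite EE tr_udiag // fmorphV.
rewrite EE udiagZ mulmxBr raddfB /= mul_udiag // tr_udiag // mxtrace_mulC tr_udiagM.
rewrite -rmorphB /=; congr (_%:C); congr (_ - _).
by apply: eq_bigr => j _; rewrite [X in h j * X]mulrC.
Qed.

Theorem lemma2 (R : realType) (n : nat) (hn : (1 <= n)%N)
    (Phi : {linear 'M[R[i]]_(2 ^ n) -> 'M[R[i]]_(2 ^ n)})
    (hPhi : quantum_channel Phi)
    (rho : 'M[R[i]]_(2 ^ n)) (hrho : density rho) :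
  let D : R := n%:R - entropy (Phi rho) in
  forall (H : 'M[R[i]]_(2 ^ n)), H \is hermsymmx -> H != 0 ->
  forall eps : R, 0 < eps ->
  exists lambda : R, 0 <= lambda <= D /\
    let E := expmx ((- (lambda / (opnorm H * eps)))%:C *: H) in
    let Z := \tr E in
    let sigma_tilde := Z^-1 *: E in
    \tr (H *m (sigma_tilde - Phi rho)) <= (opnorm H * eps)%:C.
Proof.
move=> D H Hh H0 eps eps0.
have omega_density : density (Phi rho).
  by split; [exact: channel_psdmx hPhi.1 hrho.1 | rewrite hPhi.2 hrho.2].
have omegah : Phi rho \is hermsymmx by case: omega_density => -[].
have [p0 p1] := density_spectral omega_density.
(* In bits, n is ln(2^n) / ln 2. *)
have DE : D = (\sum_i complex.Re (spectral_diag (Phi rho) 0 i) *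
    ln (complex.Re (spectral_diag (Phi rho) 0 i)) + ln (2 ^ n)%:R) / ln 2.
  rewrite /D entropyE // opprK mulrDl natrX lnXn // mulrnAl divff ?gt_eqF ?ln2_gt0 //.
  by rewrite addrC.
have c0 : 0 < opnorm H * eps by rewrite mulr_gt0 ?opnorm_gt0.
exists D; split.
  by rewrite lexx andbT DE divr_ge0 ?relent_uniform_ge0 // ltW ?ln2_gt0.
have gap := gibbs_energy_le_cst (fun j => complex.Re (spectral_diag H 0 j)) p0 p1
  (overlap_ge0 (spectralmx (Phi rho)) (spectralmx H))
  (fun i => overlap_row i (spectral_unitarymx _) (spectral_unitarymx _))
  (fun j => overlap_col j (spectral_unitarymx _) (spectral_unitarymx _)) c0.
(* The goal is an inequality in [R[i]], hence also asserts that the trace is real; [tr_gibbs_sub]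
   exhibits it as a cast real. *)
rewrite -DE -lecR in gap.
rewrite /=; apply: le_trans gap.
by rewrite -tr_gibbs_sub ?spectral_unitarymx // -!hermitian_udiag.
Qed.
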